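(* Let $N$ be the $l\times(l+r_1)$ matrix $$N=\begin{pmatrix}b_1&0&\cdots&0&d_{1,1}&\cdots&d_{r_1,1}\\0&b_2&\cdots&0&d_{1,2}&\cdots&d_{r_1,2}\\ \vdots&&\ddots&&\vdots&&\vdots\\0&0&\cdots&b_l&d_{1,l}&\cdots&d_{r_1,l}\end{pmatrix}$$ with $b_1,\dots,b_l$ positive integers and $d_{i,j}$ non-negative integers such that for each $i$ some $d_{i,j}\ne0$; let $\phi:K[x_1,\dots,x_{l+r_1}]\to K[t_1,\dots,t_l]$, $\phi(x_i)=\mathbf t^{\mathbf b_i}$ ($\mathbf b_i$ the columns of $N$). Let $D$ be an $m\times l$ rational matrix such that $M=DN$ has integer entries (columns nonzero) and such that $\ker_{\mathbb Z}(D)=\mathbb Z\mathbf a$ for some nonzero $\mathbf a\in\mathbb Z^l$. Let $w=|N|/|(N\,\mathbf a^T)|$. Then the lattice ideal $I_{N(\ker_{\mathbb Z}(M))}$ is the principal ideal generated by $F(w\mathbf a)$. Moreover, if $I_N$ is a set-theoretic complete intersection and there exists $g\in I_M$ with $\mathrm{rad}(\phi(g))=\mathrm{rad}(F(w\mathbf a))$, then $I_M$ is a set-theoretic complete intersection.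
   Context: $K$ is a field. For an integer matrix $M$ with columns $\mathbf a_i$, $I_M$ is the toric ideal (kernel of $x_i\mapsto\mathbf t^{\mathbf a_i}$ into a Laurent polynomial ring). $\ker_{\mathbb Z}(D)=\{\mathbf v\in\mathbb Z^l:D\mathbf v^T=0\}$. For an integer matrix $P$ with $l$ rows, $|P|$ denotes the greatest common divisor of its $l\times l$ minors; $(N\,\mathbf a^T)$ is the matrix obtained from $N$ by appending the column $\mathbf a^T$. For $\mathbf u\in\mathbb Z^l$, $F(\mathbf u)=\mathbf t^{\mathbf u_+}-\mathbf t^{\mathbf u_-}$ with $\mathbf u=\mathbf u_+-\mathbf u_-$, $\mathbf u_\pm\ge0$ of disjoint support. $N(\ker_{\mathbb Z}(M))=\{\sum u_i\mathbf b_i:\mathbf u\in\mathbb Z^n,M\mathbf u^T=0\}$ and $I_L=(F(\mathbf z):\mathbf z\in L)$ is the lattice ideal of $L\subseteq\mathbb Z^l$. An ideal $I$ is a set-theoretic complete intersection if $I=\mathrm{rad}(g_1,\dots,g_h)$ with $h=\mathrm{ht}(I)$. *)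

(* Defs.v *)
From HB Require Import structures.
From mathcomp Require Import all_boot all_order all_algebra.
From mathcomp Require Import mpoly.
Set Implicit Arguments. Unset Strict Implicit. Unset Printing Implicit Defensive.
Import Order.TTheory GRing.Theory Num.Theory.
Local Open Scope ring_scope.

Section Ideals.
Variable R : comNzRingType.

Definition ideal_gen (S : R -> Prop) : R -> Prop :=
  fun f => exists (k : nat) (c g : 'I_k -> R),
      (forall i, S (g i)) /\ f = \sum_(i < k) c i * g i.

Definition principal (g : R) : R -> Prop := fun f => exists q, f = q * g.

Definition radical (I : R -> Prop) : R -> Prop := fun f => exists k : nat, I (f ^+ k).

Definition same_set (I J : R -> Prop) : Prop := forall f, I f <-> J f.

Definition is_ideal (I : R -> Prop) : Prop :=
  [/\ I 0, (forall a b, I a -> I b -> I (a + b)) & (forall r a, I a -> I (r * a))].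

Definition prime_ideal (P : R -> Prop) : Prop :=
  [/\ is_ideal P, ~ P 1 & (forall a b, P (a * b) -> P a \/ P b)].

Definition strict_subset (I J : R -> Prop) : Prop :=
  (forall x, I x -> J x) /\ exists x, J x /\ ~ I x.

Definition prime_chain_below (P : R -> Prop) (n : nat) : Prop :=
  exists Q : nat -> R -> Prop,
    [/\ (forall i, (i <= n)%N -> prime_ideal (Q i)),
        (forall i, (i < n)%N -> strict_subset (Q i) (Q i.+1)) &
        same_set (Q n) P].

Definition prime_height (P : R -> Prop) (h : nat) : Prop :=
  prime_chain_below P h /\ forall n, prime_chain_below P n -> (n <= h)%N.

Definition ideal_height (I : R -> Prop) (h : nat) : Prop :=
  (exists P, [/\ prime_ideal P, (forall x, I x -> P x) & prime_height P h]) /\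
  (forall P, prime_ideal P -> (forall x, I x -> P x) -> prime_chain_below P h).

Definition stci (I : R -> Prop) : Prop :=
  exists h : nat, ideal_height I h /\
    exists g : 'I_h -> R,
      same_set I (radical (ideal_gen (fun p => exists i, p = g i))).

End Ideals.

Definition ppart (z : int) : nat := if (0 <= z) then `|z|%N else 0%N.
Definition npart (z : int) : nat := ppart (- z).

Definition tmono (K : fieldType) (l : nat) (e : 'I_l -> nat) : {mpoly K[l]} :=
  'X_[[multinom e i | i < l]].

Definition Fbin (K : fieldType) (l : nat) (u : 'rV[int]_l) : {mpoly K[l]} :=
  tmono K (fun i => ppart (u 0 i)) - tmono K (fun i => npart (u 0 i)).

Definition lattice_ideal (K : fieldType) (l : nat) (L : 'rV[int]_l -> Prop)
  : {mpoly K[l]} -> Prop :=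
  ideal_gen (fun p => exists z, L z /\ p = Fbin K z).

Definition mnm_col (n : nat) (u : 'X_{1..n}) : 'cV[int]_n := \col_j ((u j)%:Z).

(* Toric ideal I_M = kernel of K[x_1..x_n] -> K[t_1^{+-1},..,t_m^{+-1}],
   x_j |-> t^{a_j} (a_j the j-th column of M).  The image of f = sum c_u x^u
   is sum_v (sum_{u : M u = v} c_u) t^v, so f is in the kernel iff every such
   coefficient vanishes. *)
Definition toric_ideal (K : fieldType) (m n : nat) (M : 'M[int]_(m, n))
  : {mpoly K[n]} -> Prop :=
  fun f => forall v : 'cV[int]_m,
    \sum_(u <- msupp f | M *m mnm_col u == v) f@_u = 0.

Definition kerZ (m l : nat) (D : 'M[rat]_(m, l)) : 'rV[int]_l -> Prop :=
  fun v => D *m (map_mx (fun z : int => z%:~R) v)^T = 0.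

Definition gcd_minors (l k : nat) (P : 'M[int]_(l, k)) : int :=
  \big[gcdz/0]_(f : {ffun 'I_l -> 'I_k}) \det (colsub f P).

Definition image_ker (l n m : nat) (N : 'M[int]_(l, n)) (M : 'M[int]_(m, n))
  : 'rV[int]_l -> Prop :=
  fun z => exists u : 'rV[int]_n, M *m u^T = 0 /\ z = u *m N^T.

Definition Nmat (l r1 : nat) (b : 'I_l -> nat) (d : 'I_r1 -> 'I_l -> nat)
  : 'M[int]_(l, l + r1) :=
  row_mx (\matrix_(i, j) (if i == j then (b i)%:Z else 0))
         (\matrix_(j, i) (d i j)%:Z).

(* phi : x_i |-> t^{b_i}, b_i the i-th column of N (nonnegative entries) *)
Definition phi_map (K : fieldType) (l n : nat) (N : 'M[int]_(l, n))
  (g : {mpoly K[n]}) : {mpoly K[l]} :=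
  g \mPo [tuple tmono K (fun i => `|N i j|%N) | j < n].

Arguments tmono K {l} e.
Arguments Fbin K {l} u.
Arguments lattice_ideal K {l} L _.
Arguments toric_ideal K {m n} M _.
Arguments phi_map K {l n} N g.

(* Main.v *)
Require Import Defs.
From HB Require Import structures.
From mathcomp Require Import all_boot all_order all_algebra.
From mathcomp Require Import mpoly zify ring.
Import Order.TTheory GRing.Theory Num.Theory.
Local Open Scope ring_scope.
Set Implicit Arguments.
Unset Strict Implicit.
Unset Printing Implicit Defensive.
Local Notation tofrac := (@FracField.tofrac _).

(* Since ker_Z(D) = Z a, the lattice N(ker_Z(M)) is the intersection of Z a and N Z^n, which is Z (w a)
   because w is the order of a in Z^l / N Z^n; F(k w a) is a multiple of F(w a).

   If f lies in I_M, then phi(f) lies in (F(w a)), so some power phi(f)^k equals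
   q phi(g).  As t_i^{b_i} = phi(x_i), the ring K[t] is integral over the image of
   phi, and an integral equation of q multiplied by a power of phi(g) puts a power
   of f into I_N + (g).  Hence I_M = rad(g_1, ..., g_h, g) when I_N = rad(g_1, ..., g_h).

   It remains to see ht(I_M) = h + 1.  An explicit chain of toric ideals gives
   r_1 <= ht(I_N) = h, and I_N is strictly contained in I_M.  Conversely a chain of
   k + 1 primes ending at I_M has k <= r_1 + 1 by growth of Hilbert functions: if f
   lies in Q but not in the prime P, families p and q independent modulo P and Q
   give a family (f p, q) independent modulo P, so the order of growth drops by at
   least one at each step of the chain; it is at most n = l + r_1 at the bottom and
   at least l - 1 at I_M. *)

(** * Maximal minors and column lattices *)

Lemma dvdz_gcd_minorsP l k (P : 'M[int]_(l, k)) c :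
  reflect (forall f : {ffun 'I_l -> 'I_k}, (c %| \det (colsub f P))%Z)
          (c %| gcd_minors P)%Z.
Proof.
rewrite /gcd_minors; apply: (iffP idP) => [cP f | cP].
  have: f \in index_enum {ffun 'I_l -> 'I_k} by rewrite mem_index_enum.
  elim: (index_enum _) cP => // g s IHs; rewrite big_cons dvdz_gcd inE.
  by case/andP=> cg /IHs{}IHs /orP[/eqP-> | /IHs].
by elim/big_ind: _ => // x y cx cy; rewrite dvdz_gcd cx.
Qed.

Lemma gcd_minors_dvd l k (P : 'M[int]_(l, k)) (f : {ffun 'I_l -> 'I_k}) :
  (gcd_minors P %| \det (colsub f P))%Z.
Proof. by move: f; apply/dvdz_gcd_minorsP. Qed.

(** Cauchy-Binet before like terms are collected: [g] runs over all maps, as in [gcd_minors]. Each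
    factor of the Leibniz expansion is a sum over ['I_k], and distributing the product of these sums
    produces the maps [g]. *)
Lemma det_colsub_mulmx l k n (P : 'M[int]_(l, k)) (X : 'M[int]_(k, n))
    (f : {ffun 'I_l -> 'I_n}) :
  \det (colsub f (P *m X)) =
    \sum_(g : {ffun 'I_l -> 'I_k})
      (\prod_i X (g i) (f i)) * \det (colsub g P).
Proof.
rewrite -det_tr {1}/determinant.
under eq_bigr => s _.
  under [\prod_(i < l) _]eq_bigr => i _ do rewrite !mxE.
  rewrite bigA_distr_bigA big_distrr /=.
  over.
rewrite exchange_big /=; apply: eq_bigr => g _.
rewrite -[\det _]det_tr /determinant big_distrr /=; apply: eq_bigr => s _.
rewrite mulrCA; congr (_ * _); rewrite big_split /= mulrC; congr (_ * _).
by apply: eq_bigr => i _; rewrite !mxE.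
Qed.

Lemma gcd_minors_mulmx l k n (P : 'M[int]_(l, k)) (X : 'M[int]_(k, n)) :
  (gcd_minors P %| gcd_minors (P *m X))%Z.
Proof.
apply/dvdz_gcd_minorsP => f; rewrite det_colsub_mulmx.
apply: (big_ind (fun x => (gcd_minors P %| x)%Z)) => [|x y|g _].
- exact: dvdz0.
- exact: rpredD.
- by apply: dvdz_mull; apply: gcd_minors_dvd.
Qed.

Lemma gcd_minors_ge0 l k (P : 'M[int]_(l, k)) : 0 <= gcd_minors P.
Proof.
rewrite /gcd_minors; case: (index_enum _) => [|f s]; first by rewrite big_nil.
by rewrite big_cons lez_nat.
Qed.

Lemma gcd_minors_dvd_det l (H : 'M[int]_l) : (gcd_minors H %| \det H)%Z.
Proof.
have := gcd_minors_dvd H [ffun i => i].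
by congr (_ %| \det _)%Z; apply/matrixP => i j; rewrite mxE ffunE.
Qed.

Lemma det_dvd_gcd_minors l k (H : 'M[int]_l) (X : 'M[int]_(l, k)) :
  (\det H %| gcd_minors (H *m X))%Z.
Proof.
apply/dvdz_gcd_minorsP => f.
suff -> : colsub f (H *m X) = H *m colsub f X by rewrite det_mulmx dvdz_mulr.
by apply/matrixP => i j; rewrite !mxE; apply: eq_bigr => h _; rewrite !mxE.
Qed.

(* Smith normal form, used as a Hermite form: the columns of [P] and the columns
   of a square matrix [H] span the same sublattice of [Z^l]. *)
Lemma square_column_span l k (P : 'M[int]_(l, k)) : (l <= k)%N ->
  exists H : 'M[int]_l, exists X : 'M[int]_(k, l), exists Y : 'M[int]_(l, k),
    H = P *m X /\ P = H *m Y.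
Proof.
move=> le_lk; have [L uL [R uR [d _ ->]]] := int_Smith_normal_form P.
set S := (X in L *m X *m R).
pose I1 : 'M[int]_(k, l) := pid_mx l; pose I2 : 'M[int]_(l, k) := pid_mx l.
(* Since l <= k, the diagonal matrix [S] vanishes outside its first l columns, so cutting it to
   these columns and padding again loses nothing. *)
have SI : S *m I1 *m I2 = S.
  rewrite -mulmxA mul_pid_mx; apply/matrixP => i j; rewrite mxE (bigD1 (widen_ord le_lk i)) //=.
  rewrite big1 ?addr0 => [|h /negbTE nhi]; last first.
    rewrite !mxE; case: (i =P h :> nat) => [e|_]; last by rewrite mulr0n mul0r.
    by case/eqP: nhi; apply: val_inj.
  rewrite !mxE !minnn /= eqxx mulr1n; case: (i =P j :> nat) => e.
    by rewrite ltn_ord mulr1.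
  by rewrite mulr0.
exists (L *m (S *m I1)), (invmx R *m I1), (I2 *m R); split.
  by rewrite !mulmxA mulmxK.
by rewrite -[in LHS]SI !mulmxA.
Qed.

(** The two numbers divide each other: the minors of P X are combinations of those of P, and the
    minors of H Y are multiples of det H. *)
Lemma gcd_minors_square l k (P : 'M[int]_(l, k)) (H : 'M[int]_l) X Y :
  H = P *m X -> P = H *m Y -> gcd_minors P = `|\det H|.
Proof.
move=> HP PH; apply/eqP; rewrite -[gcd_minors P]ger0_norm ?gcd_minors_ge0 //.
rewrite -!abszE eqz_nat eqn_dvd -!dvdzE; apply/andP; split.
  by apply: dvdz_trans (gcd_minors_dvd_det H); have := gcd_minors_mulmx P X; rewrite -HP.
by have := det_dvd_gcd_minors H Y; rewrite -PH.
Qed.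

(** * The order of a modulo the column lattice of N *)

Section LatticeOrder.
Variables (l k : nat) (N : 'M[int]_(l, k)) (a : 'cV[int]_l).
Hypothesis le_lk : (l <= k)%N.
Hypothesis N_neq0 : gcd_minors N != 0.
Let w := (gcd_minors N %/ gcd_minors (row_mx N a))%Z.

Lemma gcd_minors_row_mx_dvd : (gcd_minors (row_mx N a) %| gcd_minors N)%Z.
Proof.
rewrite [X in (_ %| gcd_minors X)%Z](_ : N = row_mx N a *m col_mx 1%:M 0).
  exact: gcd_minors_mulmx.
by rewrite mul_row_col mulmx1 mulmx0 addr0.
Qed.

(** Let H and H' be square bases of the column lattices of N and (N a). Then H = H' T gives w = |det
    T|, and (det T) H' = H' T adj(T) = H adj(T) puts (det T) a into the column lattice of N. *)
Lemma lattice_order_mem : exists u, w *: a = N *m u.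
Proof.
have [H [X [Y [HN NH]]]] := square_column_span N le_lk.
have [|H' [X' [Y' [HN' NH']]]] := square_column_span (k := k + 1) (row_mx N a).
  by rewrite addn1 leqW.
have [eN ea] : N = H' *m lsubmx Y' /\ a = H' *m rsubmx Y'.
  by have := NH'; rewrite -{1}[Y']hsubmxK mul_mx_row => /eq_row_mx.
pose T := lsubmx Y' *m X.
have HT : H = H' *m T by rewrite mulmxA -eN.
have gN := gcd_minors_square HN NH.
have gNa := gcd_minors_square HN' NH'.
have nz : gcd_minors (row_mx N a) != 0.
  by apply: contraNneq N_neq0 => z; rewrite -dvd0z -z gcd_minors_row_mx_dvd.
have -> : w = `|\det T|.
  by rewrite /w gN HT det_mulmx normrM -gNa mulrC mulzK.
rewrite normrEsg -scalerA; exists (X *m (sgz (\det T) *: (\adj T *m rsubmx Y'))).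
rewrite mulmxA -HN HT -scalemxAr -mulmxA (mulmxA T) mul_mx_adj.
rewrite mul_scalar_mx -scalemxAr -ea //. 
Qed.

(** If c a lies in the column lattice, |N| divides every minor of (N ca). Such a minor is c times a
    minor of (N a), or equals one avoiding the last column; so |N| divides c |(N a)|, and |(N a)|
    cancels. *)
Lemma lattice_order_dvd c u : c *: a = N *m u -> (w %| c)%Z.
Proof.
move=> cau.
have Nca : (gcd_minors N %| gcd_minors (row_mx N (c *: a)))%Z.
  rewrite (_ : row_mx N (c *: a) = N *m row_mx 1%:M u) ?gcd_minors_mulmx //.
  by rewrite mul_mx_row mulmx1 cau.
have nz : gcd_minors (row_mx N a) != 0.
  by apply: contraNneq N_neq0 => z; rewrite -dvd0z -z gcd_minors_row_mx_dvd.
rewrite -(dvdz_mul2r nz) /w divzK ?gcd_minors_row_mx_dvd //.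
apply: (big_ind (fun x => (gcd_minors N %| c * x)%Z)) => [|x y dx dy|f _].
- by rewrite mulr0 dvdz0.
- by have [u1 [v1 <-]] := Bezoutz x y; rewrite mulrDr !(mulrCA c) rpredD // dvdz_mull.
(* The map [f] may select the last column twice, which gives minor 0, once, or never. *)
pose last_col i := f i == rshift k ord0.
have [[i0 i1]|one] := pickP (fun p => [&& p.1 != p.2, last_col p.1 & last_col p.2]).
  case/and3P=> /= ni /eqP e0 /eqP e1.
  by rewrite -det_tr (determinant_alternate ni) ?mulr0 ?dvdz0 // => j; rewrite !mxE e0 e1.
have scaled : \det (colsub f (row_mx N (c *: a))) =
    \det (colsub f (row_mx N a)) * \prod_i (if last_col i then c else 1).
  have -> : colsub f (row_mx N (c *: a)) =
      colsub f (row_mx N a) *m diag_mx (\row_i (if last_col i then c else 1)).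
    apply/matrixP => i j; rewrite mul_mx_diag !mxE /last_col.
    case: (splitP (f j)) => h eh; case: eqP => e.
    + by move: (ltn_ord h) eh; rewrite e /= addn0 => + eh; rewrite -eh ltnn.
    + by rewrite mulr1.
    + by rewrite !mxE mulrC.
    + by case: e; apply: val_inj; rewrite [LHS]eh ord1.
  by rewrite det_mulmx det_diag; congr (_ * _); apply: eq_bigr => i _; rewrite mxE.
have [i0 li0|none] := pickP last_col; last first.
  rewrite dvdz_mull //; move: scaled; rewrite big1 ?mulr1 => [<-|i _]; last by rewrite none.
  exact: dvdz_trans Nca (gcd_minors_dvd _ _).
move: scaled; rewrite (bigD1 i0) //= li0 big1 ?mulr1 => [|i ni].
  by rewrite mulrC => <-; apply: dvdz_trans Nca (gcd_minors_dvd _ _).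
by have /= := one (i, i0); rewrite ni li0 andbT /= => ->.
Qed.
End LatticeOrder.

(** * Toric ideals and the map phi *)

Lemma sum_fibers (V : nmodType) (I T : eqType) (s : seq I) (h : I -> T) (F : I -> V) :
  \sum_(u <- s) F u = \sum_(v <- undup (map h s)) \sum_(u <- s | h u == v) F u.
Proof.
rewrite (exchange_big_dep xpredT) //= big_seq [RHS]big_seq; apply: eq_bigr => u us.
rewrite -big_filter (eq_filter (a2 := pred1 (h u))) => [|v]; last by rewrite /= eq_sym.
by rewrite filter_pred1_uniq ?undup_uniq ?mem_undup ?map_f // big_seq1.
Qed.

Section LaurentMonomials.
Variables (K : fieldType) (m : nat).

(** Laurent polynomials are represented inside the fraction field of K[t], where the variables are
    invertible. *)
Definition laurent_const : K -> {fraction {mpoly K[m]}} :=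
  @FracField.tofrac {mpoly K[m]} \o (@mpolyC m K).
HB.instance Definition _ := GRing.RMorphism.on laurent_const.

Definition laurent_mono (v : 'cV[int]_m) : {fraction {mpoly K[m]}} :=
  \prod_i (tofrac 'X_i) ^ (v i 0).

Lemma laurent_mono0 : laurent_mono 0 = 1.
Proof. by rewrite /laurent_mono big1 // => i _; rewrite mxE expr0z. Qed.

Lemma fracX_neq0 i : tofrac ('X_i : {mpoly K[m]}) != 0.
Proof. by rewrite tofrac_eq0 -msize_poly_eq0 msizeX. Qed.

Lemma laurent_monoD v w : laurent_mono (v + w) = laurent_mono v * laurent_mono w.
Proof.
rewrite /laurent_mono -big_split; apply: eq_bigr => i _.
by rewrite mxE expfzDr ?fracX_neq0.
Qed.

Lemma laurent_monoMn v k : laurent_mono (v *+ k) = laurent_mono v ^+ k.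
Proof.
by elim: k => [|k IHk]; rewrite ?mulr0n ?laurent_mono0 // mulrS laurent_monoD IHk exprS.
Qed.

Lemma laurent_mono_sum (I : Type) (s : seq I) (F : I -> 'cV[int]_m) :
  laurent_mono (\sum_(i <- s) F i) = \prod_(i <- s) laurent_mono (F i).
Proof. exact: (big_morph _ laurent_monoD laurent_mono0). Qed.

Lemma frac_tmono (v : 'cV[int]_m) : (forall i, 0 <= v i 0) ->
  tofrac (Defs.tmono K (fun i => `|v i ord0|%N)) = laurent_mono v.
Proof.
move=> v_ge0; rewrite /Defs.tmono mpolyXE_id rmorph_prod; apply: eq_bigr => i _.
by rewrite rmorphXn mnmE /= -{2}[v i 0]gez0_abs.
Qed.

(** Multiplying by the monomial with all exponents k, where k bounds every |v_i|, makes the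
    exponents non-negative; coefficients are then compared in K[t]. *)
Lemma laurent_mono_free (s : seq 'cV[int]_m) (c : 'cV[int]_m -> K) : uniq s ->
  \sum_(v <- s) laurent_const (c v) * laurent_mono v = 0 -> {in s, forall v, c v = 0}.
Proof.
move=> us sum0 v0 v0s.
pose k := \max_(v <- s) \max_i `|v i ord0|%N.
have kv v i : v \in s -> 0 <= v i 0 + k%:Z.
  move=> vs; rewrite -lerBlDl sub0r.
  have : (`|v i ord0| <= k)%N.
    apply: (@leq_trans (\max_i `|v i ord0|%N)); first exact: (@leq_bigmax 'I_m (fun i => `|v i ord0|%N)).
    exact: (@leq_bigmax_seq _ _ xpredT (fun v : 'cV[int]_m => \max_i `|v i ord0|%N) v vs isT).
  by rewrite -lez_nat; apply: le_trans; rewrite abszE -normrN ler_norm.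
pose sh : 'cV[int]_m := const_mx k%:Z.
have shE v i : (v + sh) i 0 = v i 0 + k%:Z by rewrite !mxE.
pose e (v : 'cV[int]_m) := [multinom absz ((v + sh)%R i ord0) | i < m].
have eE v : v \in s -> tofrac 'X_[e v] = laurent_mono v * laurent_mono sh.
  move=> vs; rewrite -laurent_monoD -frac_tmono //.
  by move=> i; rewrite shE kv.
have einj v : v \in s -> (e v == e v0) = (v == v0).
  move=> vs; apply/eqP/eqP => [ev|->//]; apply/matrixP => i j; rewrite ord1.
  have := congr1 (fun u : 'X_{1..m} => (u i)%:Z) ev.
  by rewrite !mnmE !shE /= !gez0_abs ?kv // => /addIr.
have: tofrac (\sum_(v <- s) (c v)%:MP * 'X_[e v]) = 0.
  rewrite rmorph_sum big_seq /=.
  under eq_bigr => v vs do rewrite rmorphM /= (eE _ vs) mulrA.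
  by rewrite -big_seq -mulr_suml sum0 mul0r.
move/eqP; rewrite tofrac_eq0 => /eqP /(congr1 (mcoeff (e v0))).
rewrite mcoeff0 raddf_sum /= big_seq.
under eq_bigr => v vs do rewrite mcoeffCM mcoeffX (einj _ vs).
rewrite -big_seq (bigD1_seq v0) //= eqxx mulr1 big1 ?addr0 //.
by move=> v /negbTE->; rewrite mulr0.
Qed.

Lemma laurent_mono_inj : injective laurent_mono.
Proof.
move=> v w evw; apply/eqP/negPn/negP => nvw.
have := @laurent_mono_free [:: v; w] (fun z => if z == v then 1 else -1).
rewrite /= inE nvw => /(_ isT).
rewrite !big_cons big_nil eqxx eq_sym (negbTE nvw) rmorphN rmorph1 mul1r mulN1r addr0.
rewrite evw subrr => /(_ erefl v); rewrite inE eqxx => /(_ isT)/eqP.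
by rewrite oner_eq0.
Qed.

End LaurentMonomials.

Section ToricIdeal.
Variables (K : fieldType) (m n : nat) (M : 'M[int]_(m, n)).

Definition laurent_map : {mpoly K[n]} -> {fraction {mpoly K[m]}} :=
  mmap (@laurent_const K m) (fun j => laurent_mono K (col j M)).
HB.instance Definition _ := GRing.RMorphism.on laurent_map.

Lemma mulmx_mnm_col (u : 'X_{1..n}) : M *m mnm_col u = \sum_j col j M *+ u j.
Proof.
apply/matrixP => i j; rewrite mxE summxE; apply: eq_bigr => h _.
by rewrite mulmxnE !mxE -mulr_natr natz.
Qed.

Lemma laurent_map1 u :
  mmap1 (fun j => laurent_mono K (col j M)) u = laurent_mono K (M *m mnm_col u).
Proof.
rewrite mulmx_mnm_col laurent_mono_sum; apply: eq_bigr => j _.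
by rewrite laurent_monoMn.
Qed.

Lemma laurent_mapE f :
  laurent_map f =
    \sum_(u <- msupp f) laurent_const m f@_u * laurent_mono K (M *m mnm_col u).
Proof. by apply: eq_bigr => u _; rewrite laurent_map1. Qed.

Lemma laurent_mapX u : laurent_map 'X_[u] = laurent_mono K (M *m mnm_col u).
Proof. by rewrite /laurent_map mmapX laurent_map1. Qed.

(** Grouping the terms by the value of M u leaves one vanishing coefficient sum per group. The
    weight [G] is arbitrary so that representatives of the groups can be substituted for M u
    later. *)
Lemma toric_sum0 (R : nzRingType) (c : {rmorphism K -> R}) (G : 'cV[int]_m -> R) f :
  toric_ideal K M f -> \sum_(u <- msupp f) c f@_u * G (M *m mnm_col u) = 0.
Proof.
move=> If; rewrite (sum_fibers _ (fun u => M *m mnm_col u)) big1 // => v _.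
rewrite (eq_bigr (fun u => c f@_u * G v)) => [|u /eqP -> //].
by rewrite -mulr_suml -rmorph_sum If rmorph0 mul0r.
Qed.

(** This turns the coefficientwise definition into the kernel of a ring morphism to a field, from
    which primality follows. *)
Lemma toric_laurentP f : toric_ideal K M f <-> laurent_map f = 0.
Proof.
rewrite laurent_mapE; split=> [If | f0 v]; first exact: toric_sum0.
set s := msupp f; pose h u := M *m mnm_col u.
have [vs|vs] := boolP (v \in undup (map h s)); last first.
  rewrite big_seq_cond big1 // => u /andP[us /eqP e].
  by case/negP: vs; rewrite mem_undup -e; apply: (map_f h).
apply: (@laurent_mono_free _ _ (undup (map h s))
         (fun v => \sum_(u <- s | h u == v) f@_u)) vs; first exact: undup_uniq.
rewrite -[RHS]f0 [RHS](sum_fibers _ h); apply: eq_bigr => w _.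
by rewrite rmorph_sum mulr_suml; apply: eq_bigr => u /eqP <-.
Qed.

Lemma toric_prime : prime_ideal (toric_ideal K M).
Proof.
split; first split.
- by apply/toric_laurentP; rewrite rmorph0.
- by move=> f g /toric_laurentP f0 /toric_laurentP g0; apply/toric_laurentP; rewrite rmorphD /= f0 g0 addr0.
- by move=> f g /toric_laurentP g0; apply/toric_laurentP; rewrite rmorphM /= g0 mulr0.
- by move/toric_laurentP/eqP; rewrite rmorph1 oner_eq0.
- move=> f g /toric_laurentP/eqP; rewrite rmorphM /= mulf_eq0.
  by case/orP=> /eqP e; [left | right]; apply/toric_laurentP.
Qed.

Lemma toric_binomialP (u v : 'X_{1..n}) :
  toric_ideal K M ('X_[u] - 'X_[v]) <-> M *m mnm_col u = M *m mnm_col v.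
Proof.
split=> [/toric_laurentP/eqP | e].
  by rewrite rmorphB /= !laurent_mapX subr_eq0 => /eqP/laurent_mono_inj.
by apply/toric_laurentP; rewrite rmorphB /= !laurent_mapX e subrr.
Qed.
End ToricIdeal.

Lemma mnm_col_parts n (z : 'cV[int]_n) :
  mnm_col [multinom ppart (z i ord0) | i < n] - mnm_col [multinom npart (z i ord0) | i < n] = z.
Proof.
apply/matrixP => i j; rewrite [j]ord1 !mxE !mnmE /npart /ppart oppr_ge0.
case: (ltrgt0P (z i 0)) => [z0|z0|->]; rewrite ?abszN ?subr0 ?sub0r //.
- by rewrite gez0_abs ?ltW.
- by rewrite ltz0_abs ?opprK.
Qed.

Section ToricOrder.
Variables (K : fieldType) (n m1 m2 : nat) (P : 'M[int]_(m1, n)) (Q : 'M[int]_(m2, n)).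
Hypothesis kerPQ : forall u : 'cV[int]_n, P *m u = 0 -> Q *m u = 0.

Lemma toric_sub f : toric_ideal K P f -> toric_ideal K Q f.
Proof.
move=> If; apply/toric_laurentP; rewrite laurent_mapE.
(* [rep v] is an exponent u of f with P u = v, if there is one. As ker P lies in ker Q, on the
   support of f the value Q u depends only on P u, so [toric_sum0] applies. *)
pose rep v := nth 0%MM (msupp f) (find (fun u => P *m mnm_col u == v) (msupp f)).
rewrite -[RHS](toric_sum0 (@laurent_const K m2)
  (fun v => laurent_mono K (Q *m mnm_col (rep v))) If).
rewrite big_seq [RHS]big_seq; apply: eq_bigr => u us; congr (_ * laurent_mono K _).
apply/eqP; rewrite -subr_eq0 -mulmxBr; apply/eqP/kerPQ; rewrite mulmxBr.
have: has (fun u' => P *m mnm_col u' == P *m mnm_col u) (msupp f).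
  by apply/hasP; exists u.
by move/(nth_find 0%MM)/eqP => ->; rewrite subrr.
Qed.

(** The binomial with exponents z_+ and z_- separates the two ideals. *)
Lemma toric_strict (z : 'cV[int]_n) : Q *m z = 0 -> P *m z != 0 ->
  strict_subset (toric_ideal K P) (toric_ideal K Q).
Proof.
move=> Qz Pz; split; first exact: toric_sub.
exists ('X_[[multinom ppart (z i ord0) | i < n]] - 'X_[[multinom npart (z i ord0) | i < n]]).
split.
  by apply/toric_binomialP/eqP; rewrite -subr_eq0 -mulmxBr mnm_col_parts Qz.
move/toric_binomialP/eqP; rewrite -subr_eq0 -mulmxBr mnm_col_parts; exact/negP.
Qed.
End ToricOrder.

Lemma abs_minn_ppart (x y : int) : 0 <= x -> 0 <= y ->
  `|x|%N = (minn `|x| `|y| + ppart (x - y))%N.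
Proof. by rewrite /ppart; case: ifP; lia. Qed.

Lemma ppartM (k : nat) (x : int) : ppart (k%:Z * x) = (ppart x * k)%N.
Proof.
rewrite /ppart; case: k => [|k]; first by rewrite mul0r muln0.
rewrite pmulr_rge0 //; case: ifP => // _; first by rewrite abszM mulnC.
Qed.

Section PhiMap.
Variables (K : fieldType) (l n : nat) (N : 'M[int]_(l, n)).
Hypothesis N_ge0 : forall i j, 0 <= N i j.

HB.instance Definition _ := GRing.RMorphism.copy (phi_map K N)
  (comp_mpoly [tuple Defs.tmono K (fun i => `|N i j|%N) | j < n]).

Lemma frac_phi_map g : tofrac (phi_map K N g) = laurent_map N g.
Proof.
rewrite rmorph_sum; apply: eq_bigr => u _; rewrite rmorphM rmorph_prod; congr (_ * _).
apply: eq_bigr => j _; rewrite rmorphXn tnth_mktuple; congr (_ ^+ _).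
rewrite -frac_tmono => [|i]; last by rewrite mxE.
by congr (tofrac 'X_[_]); apply/mnmP => i; rewrite !mnmE mxE.
Qed.

Lemma phi_map_kernel f : toric_ideal K N f <-> phi_map K N f = 0.
Proof.
rewrite toric_laurentP -frac_phi_map; split=> [/eqP|->]; last by rewrite rmorph0.
by rewrite tofrac_eq0 => /eqP.
Qed.

Lemma mulmx_mnm_ge0 u i : 0 <= (N *m mnm_col u) i 0.
Proof. by rewrite mxE sumr_ge0 // => j _; rewrite mulr_ge0 // mxE. Qed.

Lemma phi_mapE f : phi_map K N f =
  \sum_(u <- msupp f)
     (f@_u)%:MP * Defs.tmono K (fun i => `|(N *m mnm_col u)%R i ord0|%N).
Proof.
apply/eqP; rewrite -tofrac_eq frac_phi_map laurent_mapE rmorph_sum /=.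
by apply/eqP/eq_bigr => u _; rewrite rmorphM /= frac_tmono // => i; apply: mulmx_mnm_ge0.
Qed.

Lemma tmono_subE (x y : 'cV[int]_l) :
    (forall i, 0 <= x i 0) -> (forall i, 0 <= y i 0) ->
  Defs.tmono K (fun i => `|x i ord0|%N) - Defs.tmono K (fun i => `|y i ord0|%N) =
  Defs.tmono K (fun i => minn `|x i ord0|%N `|y i ord0|%N) * Fbin K (x - y)^T.
Proof.
move=> x0 y0; rewrite /Fbin mulrBr /Defs.tmono -!mpolyXD.
congr ('X_[_] - 'X_[_]); apply/mnmP => i; rewrite mnmDE !mnmE !mxE /npart.
  exact: abs_minn_ppart.
by rewrite opprB minnC; apply: abs_minn_ppart.
Qed.

(** From phi(f) subtract the zero sum in which each u is replaced by a representative u' with M u' =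
    M u. Each difference t^(N u) - t^(N u') is a monomial times F(N(u - u')), with u - u' in ker
    M. *)
Lemma phi_toric_mem m (M : 'M[int]_(m, n)) (J : {mpoly K[l]} -> Prop) f :
    is_ideal J -> (forall z, image_ker N M z -> J (Fbin K z)) ->
  toric_ideal K M f -> J (phi_map K N f).
Proof.
case=> J0 JD JM JF If.
pose mono v := Defs.tmono K (fun i => `|(N *m mnm_col v)%R i ord0|%N).
pose rep v := nth 0%MM (msupp f) (find (fun u => M *m mnm_col u == v) (msupp f)).
have := toric_sum0 (@mpolyC l K) (fun v => mono (rep v)) If.
move/(congr1 (fun p => phi_map K N f - p)); rewrite subr0 phi_mapE -sumrB => <-.
rewrite big_seq; apply: big_ind => // u us; rewrite -mulrBr; apply: (JM).
rewrite tmono_subE; try exact: mulmx_mnm_ge0.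
apply/(JM)/JF; exists (mnm_col u - mnm_col (rep (M *m mnm_col u)))^T; split; last first.
  by rewrite -trmx_mul mulmxBr.
have: has (fun u' => M *m mnm_col u' == M *m mnm_col u) (msupp f).
  by apply/hasP; exists u.
by move/(nth_find 0%MM)/eqP => e; rewrite trmxK mulmxBr e subrr.
Qed.
End PhiMap.

Lemma FbinN (K : fieldType) l (u : 'rV[int]_l) : Fbin K (- u) = - Fbin K u.
Proof.
rewrite /Fbin opprB; congr (_ - _); congr 'X_[_]; apply/mnmP => i; rewrite !mnmE mxE //.
by rewrite /npart opprK.
Qed.

Lemma Fbin_scale (K : fieldType) l (u : 'rV[int]_l) (c : int) :
  principal (Fbin K u) (Fbin K (c *: u)).
Proof.
wlog c_ge0 : c / 0 <= c => [pos|].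
  have [/pos//|c0] := lerP 0 c; have [|q e] := pos (- c); first by lia.
  by exists (- q); rewrite -[c]opprK scaleNr FbinN e mulNr.
have [k {c c_ge0} ->] : exists k : nat, c = k by exists `|c|%N; rewrite gez0_abs.
(* For k >= 0 the binomial is X^k - Y^k with X = t^(u_+) and Y = t^(u_-), hence a multiple of X -
   Y. *)
have -> : Fbin K (k%:Z *: u) = Defs.tmono K (fun i => ppart (u 0 i)) ^+ k
                             - Defs.tmono K (fun i => npart (u 0 i)) ^+ k.
  rewrite /Fbin /Defs.tmono !mpolyXn; congr ('X_[_] - 'X_[_]);
  apply/mnmP => i; rewrite mulmnE !mnmE mxE /npart -?mulrN ppartM //.
by rewrite subrXX mulrC /Fbin; eexists.
Qed.

(** * Growth modulo a prime ideal *)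

Section Growth.
Variables (K : fieldType) (n : nat).
Implicit Types P Q : {mpoly K[n]} -> Prop.

Definition indep_mod P (I : finType) (p : I -> {mpoly K[n]}) :=
  forall c : I -> K, P (\sum_i c i *: p i) -> forall i, c i = 0.

(** A lower bound of order s^d for the Hilbert function of K[x]/P, with degrees linear in s. The
    binomial coefficient makes the induction on s follow Pascal's rule. *)
Definition growth P (d : nat) := exists E : nat, forall s : nat,
  exists p : 'I_('C(s, d)) -> {mpoly K[n]},
    (forall i, (msize (p i) <= E * s.+1)%N) /\ indep_mod P p.

(** For f in Q outside P, take the products f p with p from stage s, and a family q independent
    modulo Q. A relation modulo P also holds modulo Q, which kills the coefficients of the q;
    primality of P then removes f. *)
Lemma growth_strict P Q d : prime_ideal P -> is_ideal Q -> strict_subset P Q ->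
  growth Q d -> growth P d.+1.
Proof.
case=> [[P0 PD PM] _ primeP] [Q0 QD QM] [PQ [f [Qf Pf]]] [E growQ].
(* Each stage multiplies by f once more, so the slope has to absorb [msize f]. *)
exists (E + (msize f).+1)%N; elim=> [|s [p [sz_p ind_p]]].
  by exists (fun _ => 0); split=> [[]|c _ []].
have [q [sz_q ind_q]] := growQ s; rewrite binS.
exists (fun i => match split i with inl j => f * p j | inr j => q j end); split.
  move=> i; case: split => j.
    apply: leq_trans (msizeM_le _ _) _; apply: leq_ltn_trans (_ : msize f + _ < _)%N.
      by rewrite leq_add2l; apply: sz_p.
    by move: (msize f) => x; nia.
  apply: leq_trans (sz_q j) _; by apply: leq_mul; rewrite ?leq_addr.
move=> c; rewrite big_split_ord /=.
under eq_bigr => i _ do rewrite (unsplitK (inl i)).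
under [X in _ + X]eq_bigr => i _ do rewrite (unsplitK (inr i)).
have -> : \sum_i c (lshift _ i) *: (f * p i) = f * \sum_i c (lshift _ i) *: p i.
  by rewrite mulr_sumr; apply: eq_bigr => i _; rewrite scalerAr.
set sp := \sum_i _ *: p i; set sq := \sum_i _ => Psum.
have cq : forall i, c (rshift _ i) = 0.
  apply: ind_q; rewrite -/sq.
  rewrite (_ : sq = (f * sp + sq) + (- sp) * f); last by rewrite mulNr [sp * f]mulrC addrAC subrr add0r.
  by apply: QD; [apply: PQ | apply: QM].
have sq0 : sq = 0 by rewrite /sq big1 // => i _; rewrite cq scale0r.
have cp : forall i, c (lshift _ i) = 0.
  by apply: ind_p; move: Psum; rewrite sq0 addr0 => /primeP[].
by move=> i; rewrite -(splitK i); case: (split i) => j /=.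
Qed.

Lemma growth_chain P k d : prime_chain_below P k -> growth P d ->
  exists2 P0, growth P0 (d + k) & P0 0.
Proof.
case=> Q [primeQ strictQ QkP] gP.
have gQ : growth (Q k) d.
  have [E g] := gP; exists E => s; have [p [sz ind]] := g s.
  by exists p; split=> // c /QkP; apply: ind.
suff {gP QkP P} : forall j, (j <= k)%N -> growth (Q (k - j)%N) (d + j)%N.
  by move=> /(_ k (leqnn k)); rewrite subnn => g; exists (Q 0%N) => //; case: (primeQ 0%N isT) => -[].
elim=> [|j IHj] jk; first by rewrite subn0 addn0.
have e : (k - j = (k - j.+1).+1)%N by rewrite subnSK.
rewrite addnS; apply: growth_strict (IHj (ltnW jk)).
- by apply: primeQ; rewrite leq_subr.
- by case: (primeQ (k - j)%N); rewrite ?leq_subr.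
- by rewrite e; apply: strictQ; rewrite -e leq_subr.
Qed.

Lemma card_bmultinom_le e : (#|{: 'X_{1..n < e.+1}}| <= e.+1 ^ n)%N.
Proof.
pose g (u : 'X_{1..n < e.+1}) : {ffun 'I_n -> 'I_e.+1} := [ffun i => inord (u i)].
have le_u (u : 'X_{1..n < e.+1}) i : (u i < e.+1)%N.
  apply: leq_ltn_trans (bmdeg u); rewrite mdegE (bigD1 i) //=; exact: leq_addr.
have g_inj : injective g.
  move=> u v /ffunP guv; apply/val_inj/mnmP => i.
  by have := congr1 val (guv i); rewrite !ffunE /= !inordK.
by have := leq_card g g_inj; rewrite card_ffun !card_ord.
Qed.

(** Independence modulo P implies linear independence, so the coefficient matrix has free rows; its
    columns are the monomials of degree at most e. *)
Lemma indep_mod_card P c (p : 'I_c -> {mpoly K[n]}) e : P 0 -> indep_mod P p ->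
  (forall i, (msize (p i) <= e.+1)%N) -> (c <= e.+1 ^ n)%N.
Proof.
move=> P0 ind sz; apply: leq_trans (card_bmultinom_le e).
pose A : 'M[K]_(c, #|{: 'X_{1..n < e.+1}}|) := \matrix_(i, j) (p i)@_(bmnm (enum_val j)).
suff /eqP <- : row_free A by apply: rank_leq_col.
apply: inj_row_free => v vA; apply/rowP => i; rewrite mxE; move: i.
apply: ind; rewrite (_ : \sum_i _ = 0) //.
apply/mpolyP => u; rewrite raddf_sum mcoeff0 /=.
have [ue|ue] := ltnP (mdeg u) e.+1; last first.
  rewrite big1 // => i _; rewrite mcoeffZ memN_msupp_eq0 ?mulr0 //.
  by apply: msize_mdeg_ge; apply: leq_trans (sz i) ue.
have := congr1 (fun M : 'rV_ _ => M 0 (enum_rank (BMultinom ue))) vA.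
rewrite !mxE => vA0; rewrite -[RHS]vA0; apply: eq_bigr => i _.
by rewrite mcoeffZ mxE enum_rankK.
Qed.

Lemma expn_le_bin d t : (t ^ d <= 'C(d * t, d))%N.
Proof.
rewrite -(leq_pmul2r (fact_gt0 d)) bin_ffact -ffactnn !ffact_prod.
rewrite -[in (t ^ d)%N](card_ord d) -prod_nat_const -big_split /=.
apply: leq_prod => i _; case: t => [|t]; first by rewrite mul0n.
by rewrite mulnBr mulnC leq_sub2l // leq_pmull.
Qed.

Lemma growth_le P d : P 0 -> growth P d -> (d <= n)%N.
Proof.
move=> P0 [E g]; rewrite leqNgt; apply/negP => ltnd.
(* With s = d t, the degree bound gives E (s + 1) + 1 <= G t, hence at most G^n t^n independent
   elements. The choice t > G^n makes this smaller than t^(n+1) <= t^d <= C(s, d). *)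
pose G := (E * d.+1).+1; pose t := (G ^ n).+1.
have [p [sz ind]] := g (d * t)%N.
have := indep_mod_card (e := (E * (d * t).+1)%N) P0 ind (fun i => leqW (sz i)).
apply/negP; rewrite -ltnNge.
apply: leq_trans (expn_le_bin d t).
apply: (@leq_trans (t ^ n.+1)); last by rewrite leq_exp2l // /t ltnS expn_gt0.
apply: (@leq_ltn_trans (G ^ n * t ^ n)); last by rewrite expnS ltn_pmul2r ?expn_gt0.
rewrite -expnMn; case: (n) => // k; rewrite leq_exp2r // /G; nia.
Qed.
End Growth.

Lemma bin_le_expn s d : ('C(s, d) <= s ^ d)%N.
Proof.
apply: (@leq_trans ('C(s, d) * d`!)); first by rewrite leq_pmulr ?fact_gt0.
rewrite bin_ffact ffact_prod -[in (s ^ d)%N](card_ord d) -prod_nat_const.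
by apply: leq_prod => i _; apply: leq_subr.
Qed.

Lemma laurent_mono_free_fin (K : fieldType) m (I : finType) (v : I -> 'cV[int]_m)
    (c : I -> K) : injective v ->
  \sum_i laurent_const m (c i) * laurent_mono K (v i) = 0 -> forall i, c i = 0.
Proof.
move=> v_inj sum0 i0.
have cv i : \sum_(j | v j == v i) c j = c i.
  by rewrite (big_pred1 i) // => j; rewrite (inj_eq v_inj).
rewrite -cv.
apply: (@laurent_mono_free K m [seq v i | i <- index_enum I]
  (fun w => \sum_(j | v j == w) c j)).
- by rewrite map_inj_uniq ?index_enum_uniq.
- by rewrite big_map -[RHS]sum0; apply: eq_bigr => i _; rewrite cv.
- by rewrite map_f ?mem_index_enum.
Qed.

(** The columns of M selected by [h] are independent, so distinct monomials in these d variables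
    have distinct images. Exponents below s give s^d of them, of which C(s, d) are kept. *)
Lemma growth_toric (K : fieldType) m n (M : 'M[int]_(m, n)) d (h : 'I_d -> 'I_n) :
    injective h ->
    (forall z : 'cV[int]_n, M *m z = 0 -> (forall i, i \notin codom h -> z i 0 = 0) ->
       z = 0) ->
  growth (toric_ideal K M) d.
Proof.
move=> h_inj kerM; exists d.+1 => s.
have le_card : ('C(s, d) <= #|{ffun 'I_d -> 'I_s}|)%N.
  by rewrite card_ffun !card_ord bin_le_expn.
pose g i : {ffun 'I_d -> 'I_s} := enum_val (widen_ord le_card i).
have g_inj : injective g by move=> i j /enum_val_inj/(congr1 val)/= /val_inj.
pose u i : 'X_{1..n} := [multinom (\sum_(j | h j == k) g i j)%N | k < n].
have uh i j : u i (h j) = g i j :> nat.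
  by rewrite mnmE (big_pred1 j) // => k; rewrite (inj_eq h_inj).
exists (fun i => 'X_[u i]); split=> [i | c Ic].
  rewrite msizeX mdegE.
  have -> : (\sum_k u i k = \sum_j g i j)%N.
    by rewrite [RHS](partition_big h xpredT) //=; apply: eq_bigr => k _; rewrite mnmE.
  have : (\sum_j g i j <= \sum_(j < d) s)%N by apply: leq_sum => j _; apply/ltnW.
  by rewrite sum_nat_const card_ord; nia.
apply: (@laurent_mono_free_fin K m _ (fun i => M *m mnm_col (u i))).
  move=> i j /eqP; rewrite -subr_eq0 -mulmxBr => /eqP Mz.
  apply/g_inj/ffunP => k; apply: val_inj; rewrite /= -!uh.
  have /matrixP/(_ (h k) 0) : mnm_col (u i) - mnm_col (u j) = 0.
    apply: kerM Mz _ => p ph; rewrite !mxE !mnmE !big_pred0 ?subrr // => q;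
    by apply: contraNF ph => /eqP <-; apply: codom_f.
  by rewrite !mxE; lia.
move/toric_laurentP: Ic; rewrite raddf_sum => e; rewrite -[RHS]e; apply: eq_bigr => i _.
by rewrite /= /laurent_map mmapZ mmapX laurent_map1.
Qed.

(** * Integrality over the image of phi *)

Section Integrality.
Variables (K : fieldType) (l n : nat) (N : 'M[int]_(l, n)).
Hypothesis pure_powers : forall i, exists j b,
  (0 < b)%N /\ phi_map K N 'X_j = 'X_i ^+ b.

(** Constants are images of constants and t_i is a root of X^b - phi(x_j); integral elements are
    closed under sums and products. The argument runs in the fraction field and is pulled back by
    injectivity. *)
Lemma phi_integral q : exists2 p : {poly {mpoly K[n]}},
  p \is monic & root (map_poly (phi_map K N) p) q.
Proof.
pose emb : {mpoly K[n]} -> {fraction {mpoly K[l]}} :=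
  @FracField.tofrac {mpoly K[l]} \o phi_map K N.
pose embM := GRing.RMorphism.clone _ _ emb _.
have int_const c : integralOver embM (tofrac c%:MP).
  have phiC : c%:MP = phi_map K N c%:MP by rewrite [RHS]comp_mpolyC.
  have -> : tofrac c%:MP = embM c%:MP := congr1 _ phiC.
  exact: integral_id.
have int_var i : integralOver embM (tofrac 'X_i).
  have [j [b [b_gt0 phij]]] := pure_powers i.
  apply: (@integral_root_monic _ _ embM _ ('X^b - (embM 'X_j)%:P)).
  - exact: monicXnsubC.
  - have -> : embM 'X_j = tofrac 'X_i ^+ b by rewrite -rmorphXn -phij.
    by rewrite /root !hornerE subrr.
  - apply/integral_poly => k; rewrite coefB coefXn coefC.
    apply: integral_sub; first exact: integral_nat.
    by case: ifP => _; [apply: integral_id | apply: integral0].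
have int_X : forall (s : seq 'I_l) (m : 'X_{1..l}),
    integralOver embM (\prod_(i <- s) tofrac 'X_i ^+ m i).
  move=> s m; apply: big_ind => [|x y|i _]; [exact: integral1|exact: integral_mul|].
  elim: (m i) => [|k IHk]; first by rewrite expr0; apply: integral1.
  rewrite exprS; exact: integral_mul (int_var i) IHk.
have [p mon_p] : integralOver embM (tofrac q).
  rewrite [q]mpolyE rmorph_sum; apply: big_ind => [|x y|u _].
  - exact: integral0.
  - exact: integral_add.
  - rewrite -mul_mpolyC rmorphM; apply: integral_mul; first exact: int_const.
    rewrite mpolyXE_id rmorph_prod; under eq_bigr => i _ do rewrite rmorphXn.
    exact: int_X.
rewrite /root map_poly_comp horner_map tofrac_eq0 => pq.
by exists p.
Qed.

(* Multiply an integral equation [q^r + ... = 0] by [phi(g)^r]. *)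
Lemma phi_dvd_radical f g q : phi_map K N f = q * phi_map K N g ->
  exists r s, phi_map K N (f ^+ r + g * s) = 0.
Proof.
move=> fqg; have [p mon_p /rootP pq] := phi_integral q.
pose r := (size p).-1; have sz_p : size p = r.+1.
  by rewrite prednK // lt0n size_poly_eq0 monic_neq0.
(* Since q phi(g) = phi(f), the term p_i q^i phi(g)^r becomes p_i phi(f)^i phi(g)^(r-i). For i < r
   one factor g is taken out, whence the exponent r - 1 - i. *)
exists r, (\sum_(i < r) p`_i * g ^+ (r.-1 - i) * f ^+ i).
have := congr1 (fun y => y * phi_map K N g ^+ r) pq.
rewrite mul0r horner_coef size_map_poly_id0; last first.
  by rewrite (monicP mon_p) rmorph1 oner_eq0.
rewrite sz_p big_ord_recr /= mulrDl => <-.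
rewrite rmorphD addrC; congr (_ + _).
  rewrite rmorphM rmorph_sum mulr_sumr mulr_suml; apply: eq_bigr => i _ /=.
  rewrite coef_map /= !rmorphM !rmorphXn /= fqg exprMn.
  have -> : phi_map K N g ^+ r = phi_map K N g * phi_map K N g ^+ (r.-1 - i) * phi_map K N g ^+ i.
    by rewrite -exprS -exprD; congr (_ ^+ _); have := ltn_ord i; lia.
  by ring.
rewrite coef_map /= -[r]/(size p).-1 -/(lead_coef p) (monicP mon_p) rmorph1 mul1r.
by rewrite rmorphXn /= fqg exprMn.
Qed.
End Integrality.

(** * Ideals and chains of primes *)

Section Ideals.
Variable R : comNzRingType.
Implicit Types (S P J : R -> Prop).

Lemma principal_ideal (g : R) : is_ideal (principal g).
Proof.
split=> [|x y [q ->] [q' ->]|r x [q ->]].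
- by exists 0; rewrite mul0r.
- by exists (q + q'); rewrite mulrDl.
- by exists (r * q); rewrite mulrA.
Qed.

Lemma ideal_gen_ideal S : is_ideal (ideal_gen S).
Proof.
split.
- by exists 0%N, (fun _ => 0), (fun _ => 0); rewrite big_ord0; split=> // -[].
- move=> _ _ [k [c [g [Sg ->]]]] [k' [c' [g' [Sg' ->]]]].
  pose pair (T : Type) (u : 'I_k -> T) (v : 'I_k' -> T) i :=
    match split i with inl j => u j | inr j => v j end.
  exists (k + k')%N, (pair _ c c'), (pair _ g g'); split.
    by move=> i; rewrite /pair; case: split.
  rewrite big_split_ord /=; congr (_ + _); apply: eq_bigr => i _.
    by rewrite /pair (unsplitK (inl i)).
  by rewrite /pair (unsplitK (inr i)).
- move=> r _ [k [c [g [Sg ->]]]]; exists k, (fun i => r * c i), g; split=> //.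
  by rewrite mulr_sumr; apply: eq_bigr => i _; rewrite mulrA.
Qed.

Lemma ideal_gen_mem S x : S x -> ideal_gen S x.
Proof.
by move=> Sx; exists 1%N, (fun _ => 1), (fun _ => x); rewrite big_ord1 mul1r.
Qed.

Lemma ideal_gen_min S J : is_ideal J -> (forall x, S x -> J x) ->
  forall x, ideal_gen S x -> J x.
Proof.
case=> J0 JD JM SJ _ [k [c [g [Sg ->]]]].
by apply: big_ind => // i _; apply/JM/SJ.
Qed.

Lemma prime_radical P x : prime_ideal P -> radical P x -> P x.
Proof.
case=> _ P1 PM [k]; elim: k => [|k IHk]; first by rewrite expr0 => /P1.
by rewrite exprS => /PM[].
Qed.

(** Only the top member of the chain is replaced, by P'; the element witnessing the last strict
    inclusion still works. *)
Lemma prime_chain_widen P P' k : prime_chain_below P k -> prime_ideal P' ->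
  (forall x, P x -> P' x) -> prime_chain_below P' k.
Proof.
case=> Q [primeQ strictQ QP] primeP' PP'.
exists (fun i => if (i < k)%N then Q i else P'); split.
- by move=> i; case: ifP => // /ltnW/primeQ.
- move=> i ik; rewrite ik; case: ltnP => [|ki]; first by move=> _; apply: strictQ.
  have e : k = i.+1 by apply/eqP; rewrite eqn_leq ki.
  have [sub [x [Qx nQx]]] := strictQ i ik; split=> [y /sub | ].
    by rewrite -e => /QP/PP'.
  by exists x; split=> //; move: Qx; rewrite -e => /QP/PP'.
- by rewrite ltnn.
Qed.

Lemma prime_chain_step P P' k : prime_chain_below P k -> prime_ideal P' ->
  strict_subset P P' -> prime_chain_below P' k.+1.
Proof.
case=> Q [primeQ strictQ QP] primeP' [PP' [x [P'x Px]]].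
exists (fun i => if (i <= k)%N then Q i else P'); split.
- by move=> i; case: ifP => // /primeQ.
- move=> i; rewrite ltnS => ik; rewrite ik; case: ltnP => ki; first exact: strictQ.
  have -> : i = k by apply/eqP; rewrite eqn_leq ik.
  by split=> [y /QP/PP' // | ]; exists x; split=> // /QP.
- by rewrite ltnn.
Qed.

Lemma ideal_height_prime P h : prime_ideal P -> prime_height P h -> ideal_height P h.
Proof.
move=> primeP hP; split; first by exists P.
by move=> P' primeP' PP'; case: hP => c _; apply: prime_chain_widen c _ _.
Qed.

Lemma prime_height_ideal P h : prime_ideal P -> ideal_height P h -> prime_height P h.
Proof.
move=> primeP [[P' [primeP' PP' [_ maxP']]] minP]; split; first exact: minP.
by move=> k c; apply: maxP'; apply: prime_chain_widen c _ _.
Qed.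
End Ideals.

(** * The matrix N *)

Section SimplicialMatrix.
Variables (l r1 : nat) (b : 'I_l -> nat) (d : 'I_r1 -> 'I_l -> nat).
Hypothesis b_gt0 : forall j, (0 < b j)%N.
Notation N := (Nmat b d).

Lemma Nmat_ge0 i j : 0 <= N i j.
Proof. by rewrite /Nmat !mxE; case: split => k; rewrite !mxE //; case: ifP. Qed.

Lemma mul_Nmat (x : 'cV[int]_l) (y : 'cV[int]_r1) i :
  (N *m col_mx x y) i 0 = (b i)%:Z * x i 0 + \sum_j (d j i)%:Z * y j 0.
Proof.
rewrite /Nmat mul_row_col mxE; congr (_ + _).
  rewrite mxE (bigD1 i) //= mxE eqxx big1 ?addr0 // => j /negbTE nji.
  by rewrite mxE eq_sym nji mul0r.
by rewrite mxE; apply: eq_bigr => j _; rewrite mxE.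
Qed.

Lemma gcd_minors_Nmat_neq0 : gcd_minors N != 0.
Proof.
apply/eqP => g0; have := gcd_minors_dvd N [ffun i => lshift r1 i].
have -> : colsub [ffun i => lshift r1 i] N = diag_mx (\row_i (b i)%:Z).
  apply/matrixP => i j; rewrite mxE ffunE /Nmat row_mxEl !mxE.
  by case: (i =P j) => [->|_]; rewrite ?mulr1n ?mulr0n.
rewrite g0 dvd0z det_diag prodf_seq_eq0 => /hasP[i _] /=.
by rewrite mxE; have := b_gt0 i; lia.
Qed.

Lemma phi_Nmat_pure (K : fieldType) i : phi_map K N 'X_(lshift r1 i) = 'X_i ^+ b i.
Proof.
rewrite [LHS]mmapX mmap1U tnth_mktuple mpolyXn; congr 'X_[_]; apply/mnmP => k.
rewrite mnmE mulmnE mnm1E /Nmat row_mxEl mxE eq_sym.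
by case: (i =P k) => [->|_]; rewrite ?mul1n.
Qed.

Let B := (\prod_i b i)%N.
Let cof i := (\prod_(k | k != i) b k)%N.

Lemma prod_b_neq0 : B%:Z != 0.
Proof. by rewrite eqz_nat -lt0n prodn_gt0. Qed.

Lemma b_cof i : (b i * cof i = B)%N. Proof. by rewrite /B (bigD1 i). Qed.

Lemma Nmat_preimage (y : 'cV[int]_r1) (t : 'cV[int]_l) :
  exists x, N *m col_mx x (B%:Z *: y) = B%:Z *: t.
Proof.
(* This solves b_i x_i = B (t_i - sum_j d_(j,i) y_j) over the integers, using B = b_i [cof i]. *)
exists (\col_i ((cof i)%:Z * (t i 0 - \sum_j (d j i)%:Z * y j 0))).
apply/matrixP => i j; rewrite [j]ord1 mul_Nmat !mxE mulrA -PoszM b_cof mulrBr.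
rewrite [X in _ - X]mulr_sumr -addrA [X in _ + X](_ : _ = 0) ?addr0 //.
apply/eqP; rewrite addrC subr_eq0; apply/eqP/eq_bigr => k _.
by rewrite mxE mulrCA.
Qed.

(** The added rows force the last coordinates y_i, i >= s, to vanish. The kernels grow with s and
    reach ker N at s = r_1. *)
Definition tower_mx (s : nat) : 'M[int]_(l + r1) :=
  col_mx N (row_mx 0 (diag_mx (\row_(i < r1) (s <= i)%N%:R))).

Lemma tower_mx_kerP s (x : 'cV[int]_l) (y : 'cV[int]_r1) : tower_mx s *m col_mx x y = 0 <->
  N *m col_mx x y = 0 /\ forall i : 'I_r1, (s <= i)%N -> y i 0 = 0.
Proof.
rewrite /tower_mx mul_col_mx [X in col_mx _ X]mul_row_col mul0mx add0r mul_diag_mx.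
split=> [/eqP | [-> y0]].
  rewrite -col_mx0 => /eqP/eq_col_mx [-> /matrixP e]; split=> // i si.
  by have := e i 0; rewrite !mxE si mul1r.
rewrite (_ : \matrix_(i, j) _ = 0) ?col_mx0 //.
by apply/matrixP => i j; rewrite !mxE [j]ord1; case: leqP => [/y0->|_]; rewrite ?mulr0 ?mul0r.
Qed.

Lemma toric_Nmat_chain (K : fieldType) : prime_chain_below (toric_ideal K N) r1.
Proof.
exists (fun s => toric_ideal K (tower_mx s)); split.
- by move=> s _; apply: toric_prime.
- move=> s sr; pose i0 := Ordinal sr.
  (* A kernel vector of N whose y-part is B e_s enters the kernel exactly at step s + 1. *)
  have [x Nx] := Nmat_preimage (delta_mx i0 0) 0; rewrite scaler0 in Nx.
  apply: (toric_strict K _ (z := col_mx x (B%:Z *: delta_mx i0 0))).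
  + move=> z; rewrite -[z]vsubmxK => /tower_mx_kerP[Nz z0]; apply/tower_mx_kerP.
    by split=> // i si; apply: z0; apply: ltnW.
  + apply/tower_mx_kerP; split=> // i si; rewrite !mxE.
    by case: eqP => [e|_]; rewrite ?mulr0 //; rewrite e /= ltnn in si.
  + apply/eqP => /tower_mx_kerP[_ /(_ i0 (leqnn _))]; rewrite !mxE !eqxx mulr1.
    by apply/eqP/prod_b_neq0.
- move=> f; split; apply: toric_sub => z; rewrite -[z]vsubmxK.
    by case/tower_mx_kerP.
  by move=> Nz; apply/tower_mx_kerP; split=> // i; rewrite leqNgt ltn_ord.
Qed.
End SimplicialMatrix.

(** * The kernel of M, the lattice ideal and the height of I_M *)

Lemma ker_product m l n (D : 'M[rat]_(m, l)) (N : 'M[int]_(l, n)) (M : 'M[int]_(m, n))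
    (a : 'rV[int]_l) :
    map_mx (fun z : int => z%:~R) M = D *m map_mx (fun z : int => z%:~R) N ->
    (forall v, kerZ D v <-> exists k : int, v = k *: a) ->
  forall u : 'cV[int]_n, M *m u = 0 <-> exists k : int, N *m u = k *: a^T.
Proof.
move=> MDN kerD u; set ratz := fun z : int => z%:~R : rat in MDN *.
have MuE : map_mx ratz (M *m u) = D *m map_mx ratz (N *m u).
  by rewrite (map_mxM (intmul (1 : rat))) MDN -mulmxA -(map_mxM (intmul (1 : rat))).
have -> : M *m u = 0 <-> kerZ D (N *m u)^T.
  rewrite /kerZ map_trmx trmxK -MuE; split=> [-> | /matrixP e].
    by apply/matrixP => i j; rewrite !mxE.
  apply/matrixP => i j; have /eqP : ratz ((M *m u) i j) = 0.
    by have := e i j; rewrite mxE => ->; rewrite mxE.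
  by rewrite intr_eq0 => /eqP ->; rewrite mxE.
rewrite kerD; split=> -[k e]; exists k.
  by rewrite -[LHS]trmxK e linearZ.
by rewrite e linearZ /= trmxK.
Qed.

Section Main.
Variables (K : fieldType) (l r1 m : nat) (b : 'I_l -> nat) (d : 'I_r1 -> 'I_l -> nat).
Variables (M : 'M[int]_(m, l + r1)) (a : 'rV[int]_l).
Hypothesis b_gt0 : forall j, (0 < b j)%N.
Hypothesis a_neq0 : a != 0.
Notation N := (Nmat b d).
Hypothesis kerM : forall u : 'cV[int]_(l + r1),
  M *m u = 0 <-> exists k : int, N *m u = k *: a^T.
Notation w := (gcd_minors N %/ gcd_minors (row_mx N a^T))%Z.

Lemma image_ker_multiples z : image_ker N M z <-> exists k : int, z = k *: (w *: a).
Proof.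
have N_neq0 := gcd_minors_Nmat_neq0 d b_gt0.
split=> [[u [/kerM[c Nu] ->]] | [k ->]].
  have /dvdzP[q cE] := lattice_order_dvd N_neq0 (esym Nu).
  exists q; rewrite -[LHS]trmxK trmx_mul !trmxK Nu.
  by rewrite linearZ /= trmxK cE scalerA.
have [u wa] := lattice_order_mem a^T (leq_addr r1 l) N_neq0.
exists (k *: u^T); split.
  rewrite linearZ /= trmxK; apply/kerM; exists (k * w).
  by rewrite -scalemxAr -wa scalerA.
by rewrite -scalemxAl -trmx_mul -wa; apply/matrixP => i j; rewrite !mxE.
Qed.

Lemma lattice_ideal_principal :
  same_set (lattice_ideal K (image_ker N M)) (principal (Fbin K (w *: a))).
Proof.
move=> f; split.
  apply: ideal_gen_min; first exact: principal_ideal.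
  by move=> _ [z [/image_ker_multiples[k ->] ->]]; apply: Fbin_scale.
case=> q ->; have [_ _ mulI] := ideal_gen_ideal
  (fun p : {mpoly K[l]} => exists z, image_ker N M z /\ p = Fbin K z).
apply/mulI/ideal_gen_mem; exists (w *: a); split=> //.
by apply/image_ker_multiples; exists 1; rewrite scale1r.
Qed.

Lemma toric_strict_Nmat : strict_subset (toric_ideal K N) (toric_ideal K M).
Proof.
have [x Nx] := Nmat_preimage b d 0 a^T.
apply: (toric_strict K _ (z := col_mx x _)) => [u Nu||].
- by apply/kerM; exists 0; rewrite Nu scale0r.
- by apply/kerM; eexists; apply: Nx.
rewrite Nx; apply: contraNneq a_neq0 => e; apply/eqP/rowP => i.
have /eqP := congr1 (fun v : 'cV_l => v i 0) e.
by rewrite !mxE mulf_eq0 (negbTE (prod_b_neq0 b_gt0)) /= => /eqP.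
Qed.

Lemma growth_toric_kernel : growth (toric_ideal K M) l.-1.
Proof.
have [i0 ai0] : exists i0, a 0 i0 != 0.
  have [i0 ai0|a0] := pickP (fun i => a 0 i != 0); first by exists i0.
  case/eqP: a_neq0; apply/rowP => i; rewrite mxE; exact/eqP/negbFE/a0.
(* The chosen variables are x_i for i <= l, i different from i0, where a_(i0) is nonzero. If N z = k
   a for z supported there, row i0 gives k = 0, and then every b_i z_i = 0. *)
apply: (@growth_toric _ _ _ _ _ (fun j => lshift r1 (lift i0 j))).
  by move=> i j /lshift_inj/lift_inj.
move=> z /kerM[k]; rewrite -[z]vsubmxK => Nz supp.
have y0 : dsubmx z = 0.
  apply/matrixP => i j; rewrite [j]ord1 !mxE -[z]vsubmxK; apply: supp.
  by apply/negP => /codomP[j' /eqP]; rewrite eq_sym eq_lrshift.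
have Nzi i : (b i)%:Z * usubmx z i 0 = k * a 0 i.
  have := congr1 (fun v : 'cV_l => v i 0) Nz.
  by rewrite mul_Nmat y0 big1 ?addr0 => [|j _]; rewrite !mxE ?mulr0.
have z_i0 : usubmx z i0 0 = 0.
  have := supp (lshift r1 i0); rewrite col_mxEu; apply.
  by apply/negP => /codomP[j' /lshift_inj/eqP]; rewrite (negbTE (neq_lift _ _)).
have k0 : k = 0.
  by have /eqP := Nzi i0; rewrite z_i0 mulr0 eq_sym mulf_eq0 (negbTE ai0) orbF => /eqP.
rewrite y0 (_ : usubmx z = 0) ?col_mx0 //; apply/matrixP => i j; rewrite [j]ord1.
have /eqP := Nzi i; rewrite k0 mul0r mulf_eq0 eqz_nat mxE.
by rewrite -[_ == 0%N]negbK -lt0n b_gt0 mxE => /eqP.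
Qed.

Lemma toric_height h : ideal_height (toric_ideal K N) h ->
  ideal_height (toric_ideal K M) h.+1.
Proof.
move=> hN; have [chainN maxN] := prime_height_ideal (toric_prime K N) hN.
apply: ideal_height_prime (toric_prime K M) _; split.
  exact: prime_chain_step chainN (toric_prime K M) toric_strict_Nmat.
move=> k /growth_chain/(_ growth_toric_kernel)[P gP P0].
(* The bottom prime has growth (l - 1) + k <= l + r_1, and r_1 <= h by the explicit chain, so k <= h
   + 1. *)
have := growth_le P0 gP; have := maxN _ (toric_Nmat_chain d b_gt0 K); lia.
Qed.

Lemma stci_toric g : stci (toric_ideal K N) -> toric_ideal K M g ->
    same_set (radical (principal (phi_map K N g)))
             (radical (principal (Fbin K (w *: a)))) ->
  stci (toric_ideal K M).
Proof.
move=> [h [hN [gs IN]]] Ig rad_g; exists h.+1; split; first exact: toric_height.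
pose gs' (i : 'I_h.+1) := if unlift ord0 i is Some j then gs j else g.
have N_ge0 := @Nmat_ge0 _ _ b d.
have [idealM _ _] := toric_prime K M.
exists gs'; set J := ideal_gen _.
have idealJ : is_ideal J := ideal_gen_ideal _.
have [J0 JD JM] := idealJ.
have Jg : J g by apply: ideal_gen_mem; exists ord0; rewrite /gs' unlift_none.
have Jgs x : ideal_gen (fun p => exists i, p = gs i) x -> J x.
  apply: (ideal_gen_min idealJ) => _ [i ->].
  by apply: ideal_gen_mem; exists (lift ord0 i); rewrite /gs' liftK.
move=> f; split=> [If | radf]; last first.
  (* All the generators lie in I_M, which is prime and so contains its radical. *)
  apply: (prime_radical (toric_prime K M)); case: radf => k Jf; exists k.
  apply: ideal_gen_min idealM _ _ Jf => _ [i ->]; rewrite /gs'.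
  case: unliftP => // j _; have [NM _] := toric_strict_Nmat; apply/NM/IN.
  exists 1%N; rewrite expr1; apply: ideal_gen_mem; by exists j.
have [k [q fk]] : radical (principal (phi_map K N g)) (phi_map K N f).
  apply/rad_g; exists 1%N; rewrite expr1.
  apply: (phi_toric_mem N_ge0 (principal_ideal _)) If => z Lz.
  by apply/lattice_ideal_principal/ideal_gen_mem; exists z.
have pure i : exists j c, (0 < c)%N /\ phi_map K N 'X_j = 'X_i ^+ c.
  by exists (lshift r1 i), (b i); split=> //; apply: phi_Nmat_pure.
rewrite -rmorphXn in fk.
have [r [s]] := phi_dvd_radical pure fk.
move/(phi_map_kernel N_ge0)/IN => [t /Jgs]; set y := f ^+ k ^+ r.
move=> Jt; exists (k * r * t)%N; rewrite !exprM -/y.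
(* Here (y + g s)^t lies in J, and y^t differs from it by a multiple of g s, which is also in J. *)
rewrite -[y ^+ t](subKr ((y + g * s) ^+ t)) subrXX [y + _]addrC addrK.
apply: JD; first by rewrite addrC.
by rewrite -mulrA -mulrN mulrC; apply: JM.
Qed.
End Main.

Unset Implicit Arguments.

Theorem theorem5p6 (K : fieldType) (l r1 m : nat)
  (b : 'I_l -> nat) (d : 'I_r1 -> 'I_l -> nat)
  (D : 'M[rat]_(m, l)) (M : 'M[int]_(m, l + r1)) (a : 'rV[int]_l) :
  (forall j, (0 < b j)%N) ->
  (forall i, exists j, d i j <> 0%N) ->
  map_mx (fun z : int => z%:~R) M = D *m map_mx (fun z : int => z%:~R) (Nmat b d) ->
  (forall j, col j M != 0) ->
  a != 0 ->
  (forall v, kerZ D v <-> exists k : int, v = k *: a) ->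
  let N := Nmat b d in
  let w : int := (gcd_minors N %/ gcd_minors (row_mx N a^T))%Z in
  same_set (lattice_ideal K (image_ker N M)) (principal (Fbin K (w *: a))) /\
  ((stci (toric_ideal K N) /\
    exists g, toric_ideal K M g /\
      same_set (radical (principal (phi_map K N g)))
               (radical (principal (Fbin K (w *: a))))) ->
   stci (toric_ideal K M)).
Proof.
move=> b_gt0 _ MDN _ a_neq0 kerD N w; have kerM := ker_product MDN kerD.
split; first exact: (lattice_ideal_principal b_gt0 kerM).
case=> stciN [g [Ig rad_g]]; exact: stci_toric b_gt0 a_neq0 kerM _ stciN Ig rad_g.
Qed.
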